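(* Let $G$ be a simple $(3,4)$-biregular bigraph. Then $G$ has a path factor such that the endpoints of each of its component paths have degree $3$ in $G$.
   Context: Graphs are finite and loop-free; a simple graph has no multiple edges. A $(3,4)$-biregular bigraph is a bipartite graph $G$ with bipartition $(Y,X)$ (every edge joins a vertex of $Y$ to a vertex of $X$) in which every vertex of $Y$ has degree $3$ and every vertex of $X$ has degree $4$. $G$ is not assumed connected. A path factor of a graph $G$ is a spanning subgraph of $G$ (containing all vertices of $G$) each of whose connected components is a nontrivial path, i.e. a path with at least one edge. *)

(* Defs.v *)
From mathcomp Require Import all_boot.

Set Implicit Arguments.
Unset Strict Implicit.
Unset Printing Implicit Defensive.

(* A simple graph on the vertex set T is given by its adjacency relation. *)
Definition simple_graph (T : finType) (e : rel T) : Prop :=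
  symmetric e /\ irreflexive e.

Definition degree (T : finType) (e : rel T) (v : T) : nat :=
  #|[set w | e v w]|.

Definition bipartition (T : finType) (e : rel T) (Y X : {set T}) : Prop :=
  [/\ Y :|: X = [set: T], [disjoint Y & X] &
      forall u v, e u v ->
        (u \in Y) && (v \in X) || (u \in X) && (v \in Y)].

Definition biregular (a b : nat) (T : finType) (e : rel T) (Y X : {set T}) :
    Prop :=
  [/\ bipartition e Y X, {in Y, forall v, degree e v = a} &
      {in X, forall v, degree e v = b}].

(* A spanning subgraph has the same vertex type, so only its edges vary. *)
Definition spanning_subgraph (T : finType) (f e : rel T) : Prop :=
  simple_graph f /\ subrel f e.

Definition component (T : finType) (f : rel T) (C : {set T}) : Prop :=
  exists v, C = [set w | connect f v w].

(* The subgraph of f induced by C is the path whose successive vertices are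
   listed, without repetition, by s: the edges are exactly the pairs of
   consecutive entries of s, so a cycle has no such listing. *)
Definition path_listing (T : finType) (f : rel T) (C : {set T}) (s : seq T) :
    Prop :=
  [/\ uniq s, s =i C &
      {in C &, forall x y, f x y = infix [:: x; y] s || infix [:: y; x] s}].

Definition nontrivial_path (T : finType) (f : rel T) (C : {set T}) : Prop :=
  exists2 s, path_listing f C s & 1 < size s.

Definition path_factor (T : finType) (e f : rel T) : Prop :=
  spanning_subgraph f e /\ forall C, component f C -> nontrivial_path f C.

Definition path_endpoint (T : finType) (f : rel T) (C : {set T}) (v : T) :
    Prop :=
  exists x s, path_listing f C (x :: s) /\ (v = x \/ v = last x s).

(* Main.v *)
Require Import Defs.
From mathcomp Require Import all_boot.
From mathcomp Require Import zify.

Set Implicit Arguments.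
Unset Strict Implicit.
Unset Printing Implicit Defensive.

(* Call a spanning subgraph balanced if its degrees are 2 on X and 1 or 2 on Y.
   Balanced subgraphs exist: start from two arbitrary edges at each vertex of X
   and shift edges along alternating paths leaving an overfull or an empty
   vertex of Y.  Let F be balanced with as few components as possible, and
   suppose that some edge of F lies on a cycle.  Deleting it leaves every
   component intact but makes one vertex s of X deficient.  While s is deficient,
   add to s an unused edge sy outside F.  If y has degree 1 and lies in another
   component, the result is balanced with fewer components, a contradiction.
   Otherwise some edge of F can be deleted without creating a component beyond
   the original number, which makes another vertex of X (or s again) deficient.
   Every exchange uses up an edge of F, so the process stops.  Hence F is a
   forest of maximum degree 2 without isolated vertices, and its vertices of
   degree 1 lie in Y. *)

(** * Adding, deleting and swapping edges: effect on degrees *)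

Section EdgeSurgery.
Variable T : finType.
Implicit Types (f g : rel T) (u v w x y : T).

Definition same_edge u v : rel T :=
  [rel x y | (x == u) && (y == v) || (x == v) && (y == u)].
Definition add_edge f u v : rel T := [rel x y | f x y || same_edge u v x y].
Definition del_edge f u v : rel T := [rel x y | f x y && ~~ same_edge u v x y].
Definition swap_edge f u v x y := del_edge (add_edge f u v) x y.

Lemma same_edge_sym u v : symmetric (same_edge u v).
Proof.
by move=> x y; rewrite /same_edge /= orbC; congr (_ || _); apply: andbC.
Qed.

Lemma add_edge_sym f u v : symmetric f -> symmetric (add_edge f u v).
Proof.
by move=> sf x y; rewrite /add_edge /= sf; congr (_ || _); apply: same_edge_sym.
Qed.

Lemma del_edge_sym f u v : symmetric f -> symmetric (del_edge f u v).
Proof.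
by move=> sf x y; rewrite /del_edge /= sf; congr (_ && ~~ _); apply: same_edge_sym.
Qed.

Lemma del_edge_sub f u v : subrel (del_edge f u v) f.
Proof. by move=> x y /andP[]. Qed.

Lemma add_edge_sub f u v : subrel f (add_edge f u v).
Proof. by move=> x y; rewrite /add_edge /= => ->. Qed.

Lemma add_edge_new f u v : add_edge f u v u v.
Proof. by rewrite /add_edge /same_edge /= !eqxx orbT. Qed.

Lemma degree_add_edge f u v w :
    symmetric f -> u != v -> ~~ f u v ->
  degree (add_edge f u v) w = degree f w + (w == u) + (w == v).
Proof.
move=> sf uv nf; rewrite /degree.
have [->|wu] := eqVneq w u.
  rewrite (negbTE uv) addn0 addn1.
  have -> : [set z | add_edge f u v u z] = v |: [set z | f u z].
    apply/setP => z; rewrite !inE /add_edge /same_edge /= eqxx (negbTE uv) /=.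
    by rewrite orbF orbC.
  by rewrite cardsU1 inE nf add1n.
have [->|wv] := eqVneq w v; last first.
  rewrite !addn0; apply: eq_card => z; rewrite !inE /add_edge /same_edge /=.
  by rewrite (negbTE wu) (negbTE wv) /= orbF.
rewrite addn0 addn1.
have -> : [set z | add_edge f u v v z] = u |: [set z | f v z].
  apply/setP => z; rewrite !inE /add_edge /same_edge /= eqxx.
  by rewrite [v == u]eq_sym (negbTE uv) /= orbC.
by rewrite cardsU1 inE sf nf add1n.
Qed.

Lemma add_del_edge f u v :
  symmetric f -> f u v -> add_edge (del_edge f u v) u v =2 f.
Proof.
move=> sf fuv x y; rewrite /add_edge /del_edge /=.
case: (boolP (same_edge u v x y)) => /= [/orP[]|_].
- by case/andP=> /eqP-> /eqP->; rewrite fuv orbT.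
- by case/andP=> /eqP-> /eqP->; rewrite sf fuv orbT.
by rewrite andbT orbF.
Qed.

Lemma eq_degree f g : f =2 g -> degree f =1 degree g.
Proof. by move=> fg w; apply: eq_card => z; rewrite !inE fg. Qed.

Lemma degree_del_edge f u v w :
    symmetric f -> u != v -> f u v ->
  degree f w = degree (del_edge f u v) w + (w == u) + (w == v).
Proof.
move=> sf uv fuv; rewrite -degree_add_edge //; first 1 last.
- exact: del_edge_sym.
- by rewrite /del_edge /same_edge /= !eqxx andbF.
by apply: eq_degree => x y; rewrite add_del_edge.
Qed.

(** The losses stand on the left, so no truncated subtraction occurs and the four ends may coincide
    across the two edges. *)
Lemma degree_swap_edge f u v x y w :
    symmetric f -> u != v -> ~~ f u v -> x != y -> f x y ->
  degree (swap_edge f u v x y) w + (w == x) + (w == y)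
    = degree f w + (w == u) + (w == v).
Proof.
move=> sf uv nf xy fxy; rewrite -(degree_add_edge w sf uv nf).
by rewrite -degree_del_edge ?add_edge_sub //; apply: add_edge_sym.
Qed.

Lemma swap_edge_sym f u v x y : symmetric f -> symmetric (swap_edge f u v x y).
Proof. by move=> sf; apply/del_edge_sym/add_edge_sym. Qed.

Lemma swap_edge_sub f e u v x y :
    symmetric e -> subrel f e -> e u v -> subrel (swap_edge f u v x y) e.
Proof.
move=> se fe euv a b /andP[/orP[/fe //|/orP[]/andP[/eqP-> /eqP->] //] _].
by rewrite se.
Qed.

Lemma degree_gt0P f v : reflect (exists w, f v w) (0 < degree f v).
Proof.
by apply: (iffP card_gt0P) => -[w]; rewrite ?inE => fvw; exists w; rewrite ?inE.
Qed.

Lemma degree_gt1P f v :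
  reflect (exists x y, [/\ f v x, f v y & x != y]) (1 < degree f v).
Proof.
apply: (iffP card_gt1P) => -[x [y]]; rewrite ?inE => -[fx fy xy];
  by exists x, y; rewrite ?inE.
Qed.

Lemma degree_gt2 f v x y z :
  f v x -> f v y -> f v z -> uniq [:: x; y; z] -> 2 < degree f v.
Proof.
move=> fx fy fz un; rewrite -[2.+1]/(size [:: x; y; z]) -(card_uniqP un).
by apply/subset_leq_card/subsetP => w; rewrite !inE => /or3P[]/eqP->.
Qed.

Lemma degree1_eq f v x y : degree f v <= 1 -> f v x -> f v y -> x = y.
Proof.
move=> d fx fy; apply/eqP/idPn => xy; move: d; rewrite leqNgt => /negP; apply.
by apply/degree_gt1P; exists x, y.
Qed.

Definition diff_rel (e f : rel T) : rel T := [rel x y | e x y && ~~ f x y].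

Lemma degree_diff_rel (e f : rel T) v :
  subrel f e -> degree e v = degree f v + degree (diff_rel e f) v.
Proof.
move=> fe; rewrite /degree -(cardsID [set w | f v w] [set w | e v w]).
congr (_ + _); apply: eq_card => w; rewrite !inE.
  by case: (boolP (f v w)) => [/fe ->|]; rewrite ?andbF.
by rewrite andbC.
Qed.

(** * Connectivity and the number of components under edge changes *)

Lemma sub_connect f g : subrel f g -> subrel (connect f) (connect g).
Proof. by move=> fg; apply: connect_sub => x y /fg /connect1. Qed.

Lemma connect_add_edge f u v a b :
    connect (add_edge f u v) a b ->
  [|| connect f a b, connect f a u && connect f v b
    | connect f a v && connect f u b].
Proof.
case/connectP=> p + ->; elim: p a => [|c p IH] a /=; first by rewrite connect0.
case/andP=> ac /IH {IH}; case/or3P: ac => [fac||].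
- have ac := connect1 fac.
  case/or3P=> [cb|/andP[cu vb]|/andP[cv ub]]; apply/or3P.
  + exact/Or31/(connect_trans ac).
  + by apply: Or32; rewrite (connect_trans ac).
  + by apply: Or33; rewrite (connect_trans ac).
- case/andP=> /eqP-> /eqP-> /or3P[vb|/andP[_ ->]|/andP[_ ->]];
    by rewrite ?vb ?connect0 ?orbT.
- case/andP=> /eqP-> /eqP-> /or3P[vb|/andP[_ ->]|/andP[_ ->]];
    by rewrite ?vb ?connect0 ?orbT.
Qed.

(** Each component of the larger graph selects an old root inside it, the merged component selecting
    that of [v]. This selection [h] is injective and misses the old root of [u]. *)
Lemma n_comp_add_edge_lt f u v :
    symmetric f -> ~~ connect f u v ->
  n_comp (add_edge f u v) predT < n_comp f predT.
Proof.
move=> sf nuv; set g := add_edge f u v.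
have cf : connect_sym f by apply: sym_connect_sym.
have cg : connect_sym g by apply/sym_connect_sym/add_edge_sym.
have fg : subrel (connect f) (connect g) by apply/sub_connect/add_edge_sub.
have guv : connect g u v by apply/connect1/add_edge_new.
pose h r := if connect g u r then root f v else root f r.
have hinj : {in roots g &, injective h}.
  move=> r1 r2 /eqP R1 /eqP R2; rewrite /h.
  have gv r : root f v = root f r -> connect g u r.
    by move/eqP; rewrite (root_connect cf) => /fg; apply: connect_trans.
  case: ifP => u1; case: ifP => u2.
  - by move=> _; rewrite -R1 -R2; apply/(rootP cg); rewrite -(same_connect cg u1).
  - by move/gv; rewrite u2.
  - by move/esym/gv; rewrite u1.
  - move/eqP; rewrite (root_connect cf) => /fg c12.
    by rewrite -R1 -R2; apply/(rootP cg).
rewrite /n_comp_mem; set A := (X in #|X| < _).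
rewrite -(card_in_image (f := h) (A := A)); last first.
  by move=> x y /andP[/= Rx _] /andP[/= Ry _]; apply: hinj.
apply: proper_card; apply/properP; split.
  apply/subsetP => z /imageP[r _ ->]; rewrite !inE andbT /h.
  by case: ifP => _; rewrite (roots_root cf).
exists (root f u); first by rewrite !inE (roots_root cf).
apply/negP => /imageP[r _]; rewrite /h; case: ifP => [_|ur] /eqP;
  rewrite (root_connect cf) => c; first by rewrite c in nuv.
by rewrite (fg _ _ c) in ur.
Qed.

(** Two old roots that become connected lie in the old components of [u] and [v]. Once the root of
    [u] is set aside, [root g] is therefore injective on the others. *)
Lemma n_comp_le_add_edge f u v :
  symmetric f -> n_comp f predT <= (n_comp (add_edge f u v) predT).+1.
Proof.
move=> sf; set g := add_edge f u v.
have cf : connect_sym f by apply: sym_connect_sym.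
have cg : connect_sym g by apply/sym_connect_sym/add_edge_sym.
rewrite /n_comp_mem (cardD1 (root f u)) !inE (roots_root cf) add1n ltnS.
set A := (X in #|X| <= _).
have Ainj : {in A &, injective (root g)}.
  move=> r1 r2; rewrite !inE !andbT => /andP[n1 /eqP R1] /andP[n2 /eqP R2].
  move/eqP; rewrite (root_connect cg) => /connect_add_edge.
  case/or3P => [c|/andP[c _]|/andP[_ c]].
  - by rewrite -R1 -R2; apply/(rootP cf).
  - by move: n1; rewrite -{1}R1 (root_connect cf) c.
  - by move: n2; rewrite -{1}R2 (root_connect cf) cf c.
rewrite -(card_in_image Ainj); apply/subset_leq_card/subsetP => z /imageP[r _ ->].
by rewrite !inE andbT (roots_root cg).
Qed.

Lemma connect_del_edge f u v :
    symmetric f -> connect (del_edge f u v) u v ->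
  connect (del_edge f u v) =2 connect f.
Proof.
move=> sf c; have cd : connect_sym (del_edge f u v).
  exact/sym_connect_sym/del_edge_sym.
move=> a b; apply/idP/idP; first exact/sub_connect/del_edge_sub.
apply: connect_sub => {a b} x y fxy.
case: (boolP (same_edge u v x y)) => [/orP[]/andP[/eqP-> /eqP->] //|n].
  by rewrite cd.
by apply: connect1; rewrite /del_edge /= fxy.
Qed.

Lemma n_comp_del_edge f u v :
    symmetric f -> connect (del_edge f u v) u v ->
  n_comp (del_edge f u v) predT = n_comp f predT.
Proof. by move=> sf c; apply/eq_n_comp/connect_del_edge. Qed.

Lemma path_del_edge f u v x p :
  u \notin x :: p -> path f x p -> path (del_edge f u v) x p.
Proof.
move=> un; apply: (sub_in_path (P := [pred z | z != u])) => [a b ua ub fab|].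
  by rewrite /del_edge /same_edge /= fab (negbTE ua) (negbTE ub) !andbF.
by apply/allP => z zp; apply: contraNneq un => <-.
Qed.

(** A path without repetition never returns to [u], so after its first edge it does not use that
    edge again. *)
Lemma connect_first_edge f u v :
    connect f u v -> u != v ->
  exists2 w, f u w & connect (del_edge f u w) w v.
Proof.
case/connectP=> p0 fp ->; case/shortenP: fp => -[|w p] //=.
  by rewrite eqxx.
case/andP=> fuw fp /andP[un _] _ _; exists w => //.
by apply/connectP; exists p => //; apply: path_del_edge.
Qed.

Lemma n_comp_add_edge_le f u v :
  symmetric f -> n_comp (add_edge f u v) predT <= n_comp f predT.
Proof.
move=> sf; have [c|/(n_comp_add_edge_lt sf)/ltnW //] := boolP (connect f u v).
suff E : connect (add_edge f u v) =2 connect f by rewrite (eq_n_comp E).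
move=> x y; apply/idP/idP; last exact/sub_connect/add_edge_sub.
apply: connect_sub => {x y} x y /orP[/connect1 //|].
by case/orP=> /andP[/eqP-> /eqP->] //; rewrite sym_connect_sym.
Qed.

(** Either the new edge merges two components, which pays for the one that the deletion may split
    off, or the deleted edge lies on a cycle and its deletion splits nothing. *)
Lemma n_comp_swap_edge_le f u v a b :
    symmetric f -> f a b ->
    ~~ connect f u v \/ connect (swap_edge f u v a b) a b ->
  n_comp (swap_edge f u v a b) predT <= n_comp f predT.
Proof.
move=> sf fab; have sg := add_edge_sym u v sf; case=> [nc|c].
  apply: leq_trans (n_comp_add_edge_lt sf nc).
  have := n_comp_le_add_edge a b (swap_edge_sym u v a b sf).
  rewrite (@eq_n_comp _ (add_edge (swap_edge f u v a b) a b) (add_edge f u v)) //.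
  by apply/eq_connect/add_del_edge; rewrite ?add_edge_sub.
by rewrite n_comp_del_edge // n_comp_add_edge_le.
Qed.

(** * Paths in graphs of maximum degree 2 *)

Lemma infix2P a b (s : seq T) :
  reflect (exists l r, s = l ++ [:: a, b & r]) (infix [:: a; b] s).
Proof. exact: (@infixP _ [:: a; b] s). Qed.

Lemma sorted_infix2 f a b s : sorted f s -> infix [:: a; b] s -> f a b.
Proof.
move=> + /infix2P[l [r E]]; rewrite {s}E => /cat_sorted2[_] /=.
by case/andP.
Qed.

(** The neighbours along [s], two at an inner entry and one at an end, already exhaust the degrees.
    The default [z] is never reached, since [s] is nonempty. *)
Lemma sorted_neighbors f z s a b :
    symmetric f -> (forall v, degree f v <= 2) ->
    sorted f s -> uniq s -> 1 < size s ->
    degree f (head z s) <= 1 -> degree f (last z s) <= 1 ->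
    a \in s -> f a b ->
  infix [:: a; b] s || infix [:: b; a] s.
Proof.
move=> sf d2 + + + + + sa fab; case/splitPr: sa => l r.
have consec c d t t' : sorted f (t ++ [:: c, d & t']) -> f c d.
  by move/sorted_infix2; apply; apply/infix2P; exists t, t'.
case/lastP: l => [|l c].
  case: r => [|d r] //= /andP[fad _] _ _ d1 _.
  by rewrite (degree1_eq d1 fab fad) !eqxx prefix0s.
rewrite cat_rcons; case: r => [|d r] so un _ _.
  rewrite last_cat /= => d1.
  have fca := consec _ _ _ _ so.
  rewrite (degree1_eq d1 fab (etrans (sf a c) fca)).
  by apply/orP; right; apply/infix2P; exists l, [::].
move=> _; have fca := consec _ _ _ _ so.
have fad : f a d by move: so; rewrite -cat_rcons => /consec.
have [->|bc] := eqVneq b c.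
  by apply/orP; right; apply/infix2P; exists l, (d :: r).
have [->|bd] := eqVneq b d.
  by apply/orP; left; apply/infix2P; exists (rcons l c), r; rewrite cat_rcons.
have := d2 a; rewrite leqNgt => /negP[].
apply: (degree_gt2 fab (etrans (sf a c) fca) fad).
rewrite /= !inE negb_or bc bd /= andbT.
move: un; rewrite cat_uniq => /and3P[_ _] /= /andP[].
by rewrite !inE !negb_or => /and3P[].
Qed.

(** By [sorted_neighbors] a path from [u] to [v] without repetition is closed under [f], so it
    contains [w]. An inner vertex has two neighbours on the path, so [w] can only be the end [v]. *)
Lemma connect_leaf_unique f u v w :
    symmetric f -> (forall x, degree f x <= 2) ->
    degree f u <= 1 -> degree f v <= 1 -> degree f w <= 1 ->
    connect f u v -> connect f u w -> u != v -> u != w ->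
  v = w.
Proof.
move=> sf d2 du dv dw /connectP[p0 fp0 Ev]; rewrite {v}Ev in dv *.
case/shortenP: fp0 dv => p fp un _ {p0} dv cuw uv uw.
have sp : 0 < size p by case: p {fp un dv} uv => //=; rewrite eqxx.
have nbr a b : a \in u :: p -> f a b ->
    infix [:: a; b] (u :: p) || infix [:: b; a] (u :: p).
  exact: (@sorted_neighbors f u).
have /closed_connect/(_ _ _ cuw) : closed f [in u :: p].
  apply: intro_closed => [|a b fab ap]; first exact: sym_connect_sym.
  by case/orP: (nbr _ _ ap fab) => /mem_infix; apply; rewrite !inE eqxx ?orbT.
rewrite !inE eqxx eq_sym (negbTE uw) /= => /esym wp.
case/splitPr: wp fp un {dv sp nbr uv} => p1 [|z p2]; first by rewrite last_cat.
rewrite -cat_cons => fp un.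
have fwz : f w z by move: fp; rewrite cat_path /= => /and4P[].
have fwl : f w (last u p1).
  by rewrite sf; move: fp; rewrite cat_path /= => /and3P[].
have zl := degree1_eq dw fwz fwl.
move: un; rewrite cat_uniq => /and3P[_ /hasPn/(_ z)].
by rewrite zl mem_last !inE eqxx !orbT => /(_ isT).
Qed.
End EdgeSurgery.

(** * Double counting of edges *)

Lemma leq_sum_degree (T : finType) (f : rel T) (A B : {set T}) :
    symmetric f -> {in A, forall x y, f x y -> y \in B} ->
  \sum_(x in A) degree f x <= \sum_(y in B) degree f y.
Proof.
move=> sf AB.
have E C x : \sum_(y in C) (f x y : nat) <= degree f x.
  rewrite /degree -sum1dep_card big_mkcond [leqRHS]big_mkcond /=.
  by apply: leq_sum => y _; case: (y \in C); case: (f x y).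
have EA x : x \in A -> degree f x = \sum_(y in B) (f x y : nat).
  move=> xA; rewrite /degree -sum1dep_card big_mkcond [RHS]big_mkcond /=.
  apply: eq_bigr => y _; have := AB x xA y.
  by case: (f x y) => [->|] //; case: (y \in B).
rewrite (eq_bigr _ EA) exchange_big /=; apply: leq_sum => y _.
by under eq_bigr do rewrite sf.
Qed.

(* Were [A] nonempty, the double counts [2 #|A| <= 2 #|Z|] and
   [2 #|Z| <= #|A|] would contradict each other. *)
Lemma closed_set_empty (T : finType) (f g : rel T) (A Z : {set T}) :
    symmetric f -> symmetric g ->
    {in A, forall y x, f y x -> x \in Z} ->
    {in Z, forall x y, g x y -> y \in A} ->
    {in A, forall y, 2 <= degree f y} -> {in A, forall y, degree g y <= 1} ->
    {in Z, forall x, degree f x = 2} -> {in Z, forall x, degree g x = 2} ->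
  A = set0.
Proof.
move=> sf sg AZ ZA fA gA fZ gZ; apply/eqP; rewrite -cards_eq0.
have := leq_sum_degree sf AZ; have := leq_sum_degree sg ZA.
rewrite (eq_bigr _ gZ) (eq_bigr _ fZ) !sum_nat_const.
have : \sum_(y in A) 2 <= \sum_(y in A) degree f y by apply: leq_sum.
have : \sum_(y in A) degree g y <= \sum_(y in A) 1 by apply: leq_sum.
by rewrite !sum_nat_const; lia.
Qed.

(** * Balanced subgraphs *)

Section Bigraph.
Variables (T : finType) (e : rel T) (Y X : {set T}).
Hypotheses (Gsimple : simple_graph e) (Gbireg : biregular 3 4 e Y X).
Implicit Types (f g : rel T) (s u v w x y a b : T).

Let se : symmetric e. Proof. by case: Gsimple. Qed.

Lemma bipart_disj x : x \in X -> x \in Y -> False.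
Proof. by case: Gbireg => -[_ d _] _ _ xX /(disjointFr d); rewrite xX. Qed.

Lemma bipart_YX y x : y \in Y -> e y x -> x \in X.
Proof.
move=> yY eyx; case: Gbireg => -[_ _ /(_ _ _ eyx)] + _ _.
by case/orP=> /andP[] // /bipart_disj/(_ yY).
Qed.

Lemma bipart_XY x y : x \in X -> e x y -> y \in Y.
Proof.
move=> xX exy; case: Gbireg => -[_ _ /(_ _ _ exy)] + _ _.
by case/orP=> /andP[] // /(bipart_disj xX).
Qed.

Lemma bipart_neq x y : x \in X -> y \in Y -> x != y.
Proof. by move=> xX; apply: contraTneq => <-; apply/negP/bipart_disj. Qed.

Lemma bipart_cover v : (v \in Y) || (v \in X).
Proof. by case: Gbireg => -[/setP/(_ v)]; rewrite !inE. Qed.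

Lemma degree_Y y : y \in Y -> degree e y = 3.
Proof. by case: Gbireg => _ + _; apply. Qed.

Lemma degree_X x : x \in X -> degree e x = 4.
Proof. by case: Gbireg => _ _; apply. Qed.

Definition half f :=
  [/\ symmetric f, subrel f e & {in X, forall x, degree f x = 2}].

Definition balanced f :=
  half f /\ {in Y, forall y, 0 < degree f y <= 2}.

Lemma half_exists : exists f, half f.
Proof.
pose S x := [set y in take 2 (enum [set y | e x y])].
have SE x y : y \in S x -> e x y.
  by rewrite inE => /mem_take; rewrite mem_enum inE.
exists (fun u v => (u \in X) && (v \in S u) || (v \in X) && (u \in S v)).
split=> [u v|u v|x xX]; first by rewrite orbC.
  by case/orP=> /andP[_ /SE] //; rewrite se.
transitivity #|S x|.
  apply: eq_card => y; rewrite inE xX /=.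
  case: (boolP (y \in X)) => yX /=; last by rewrite orbF.
  suff -> : (x \in S y) = false by rewrite orbF.
  by apply/negP => /SE/(bipart_XY yX)/(bipart_disj xX).
rewrite /S cardsE (card_uniqP _) ?take_uniq ?enum_uniq //.
by rewrite size_take -cardE -/(degree e x) degree_X.
Qed.

(** Exchanging the edge [y x] for [x y'] moves one unit of degree from [y] to [y'] and leaves the
    degree of [x] unchanged. *)
Definition shift_step f : rel T :=
  fun y y' => [exists x, [&& f y x, e x y' & ~~ f x y']].

(** The first exchange alters [f] only in an edge at [y] and one at [y1]. A path without repetition
    neither leaves [y] nor enters [y1] again, so its later steps survive; gains and losses at inner
    vertices cancel. *)
Lemma shift_path f y p :
    half f -> y \in Y -> path (shift_step f) y p -> uniq (y :: p) ->
  exists2 f', half f' &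
    forall v, degree f' v + (v == y) = degree f v + (v == last y p).
Proof.
elim: p f y => [|y1 p IH] f y [sf fe fX] yY /=; first by exists f.
case/andP=> /existsP[x /and3P[fyx exy1 nf]] pth /andP[yp un].
have xX := bipart_YX yY (fe _ _ fyx); have y1Y := bipart_XY xX exy1.
have [xy xy1] := (bipart_neq xX yY, bipart_neq xX y1Y).
have D v := degree_swap_edge v sf xy1 nf xy (etrans (sf x y) fyx).
set g := swap_edge f x y1 x y in D.
have D' v : degree g v + (v == y) = degree f v + (v == y1).
  by move: (D v); rewrite addnAC [RHS]addnAC => /addIn.
have hg : half g.
  split; [exact: swap_edge_sym|exact: swap_edge_sub|].
  move=> z zX; have := D' z; rewrite fX //.
  by rewrite (negbTE (bipart_neq zX yY)) (negbTE (bipart_neq zX y1Y)) !addn0.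
have [||f' hf' E] := IH g y1 hg y1Y; last 1 first.
- exists f' => // v; have := D' v; have := E v.
  case: (eqVneq v y) => [->|]; case: (v == y1); case: (v == last y1 p) => /=;
    clear; lia.
- case/andP: un => y1p _.
  have sub a b :
      a \in Y -> a != y -> b != y1 -> shift_step f a b -> shift_step g a b.
    move=> aY ay by1 /existsP[z /and3P[faz ezb nfzb]]; apply/existsP; exists z.
    have zX := bipart_YX aY (fe _ _ faz); have bY := bipart_XY zX ezb.
    rewrite ezb /g /swap_edge /del_edge /add_edge /same_edge /= faz (negbTE ay) /=.
    rewrite (negbTE nfzb) (negbTE by1) eq_sym (negbTE (bipart_neq xX aY)) !andbF /=.
    by rewrite [b == x]eq_sym (negbTE (bipart_neq xX bY)) /= !andbF.
  have subpath q a : a \in Y -> a != y -> y \notin q -> y1 \notin q ->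
      path (shift_step f) a q -> path (shift_step g) a q.
    elim: q a => //= b q IHq a aY ay; rewrite !inE !negb_or.
    case/andP=> yb yq /andP[y1b y1q] /andP[ab bq].
    rewrite sub // 1?eq_sym //=; apply: IHq => //; last by rewrite eq_sym.
    case/existsP: ab => z /and3P[faz ezb _].
    exact: bipart_XY (bipart_YX aY (fe _ _ faz)) ezb.
  move: yp; rewrite inE negb_or => /andP[yy1 yp].
  by apply: subpath; rewrite // eq_sym.
- exact: un.
Qed.

Notation compl := (diff_rel e).

(** Since 4 = 2 + 2, complements in [e] are again half. This symmetry reduces empty vertices of [Y]
    to overfull ones. *)
Lemma half_compl f : half f -> half (compl f).
Proof.
case=> sf fe fX; split=> [u v|u v /andP[] //|x xX].
  by rewrite /diff_rel /= se sf.
by have := degree_diff_rel x fe; rewrite degree_X // fX //; clear; lia.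
Qed.

(** Otherwise every vertex reachable from [y] has degree at least 2 in [f], hence at most 1 in the
    complement. The reachable set [A] and its neighbourhood [Z] then satisfy [closed_set_empty],
    although [y] is in [A]. *)
Lemma overfull_shift f y :
    half f -> y \in Y -> degree f y = 3 ->
  exists2 z, connect (shift_step f) y z & z \in Y /\ degree f z <= 1.
Proof.
move=> hf yY fy; have [[sf fe fX] [sg _ gX]] := (hf, half_compl hf).
pose A := [set z in Y | connect (shift_step f) y z].
pose Z := [set x in X | [exists z in A, f z x]].
case: (boolP [exists z in A, degree f z <= 1]) => [/exists_inP[z]|/exists_inPn fA].
  by rewrite inE => /andP[zY yz] d; exists z.
suff A0 : A = set0 by have := in_set0 y; rewrite -A0 inE yY connect0.
apply: (closed_set_empty (f := f) (g := compl f) (Z := Z)) => //.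
- move=> z zA x fzx; rewrite inE; apply/andP; split.
    by move: zA; rewrite inE => /andP[zY _]; apply: bipart_YX zY (fe _ _ fzx).
  by apply/exists_inP; exists z.
- move=> x; rewrite inE => /andP[xX /exists_inP[z zA fzx]] w /andP[exw nf].
  rewrite inE (bipart_XY xX exw); move: zA; rewrite inE => /andP[_ yz].
  by apply: connect_trans yz (connect1 _); apply/existsP; exists x; rewrite fzx exw.
- by move=> z /fA; rewrite -ltnNge.
- move=> z zA; have := fA z zA; have := degree_diff_rel z fe.
  by move: zA; rewrite inE => /andP[zY _]; rewrite degree_Y //; clear; lia.
- by move=> x; rewrite inE => /andP[/fX].
- by move=> x; rewrite inE => /andP[/gX].
Qed.

Definition unbalanced f := [set y in Y | (degree f y == 0) || (degree f y == 3)].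

(** Shifting along a path lowers [y] from 3 to 2 and raises a vertex of degree 0 or 1 to 1 or 2, so
    no vertex becomes unbalanced. *)
Lemma overfull_fix f y :
    half f -> y \in Y -> degree f y = 3 ->
  exists2 f', half f' & #|unbalanced f'| < #|unbalanced f|.
Proof.
move=> hf yY fy; have [z] := overfull_shift hf yY fy.
case/connectP=> p0 pth ->; case/shortenP: pth => p pth un _ {p0} [zY dz].
have [f' hf' D] := shift_path hf yY pth un; exists f' => //.
have neq : (last y p == y) = false.
  by apply/eqP => E; rewrite E fy in dz.
apply/proper_card/properP; split; last first.
  exists y; rewrite inE yY ?fy //.
  by have := D y; rewrite fy eqxx [y == _]eq_sym neq; clear; lia.
apply/subsetP => v; rewrite !inE => /andP[vY]; rewrite vY /=.
have := D v; have [->|vy] := eqVneq v y; first by rewrite fy.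
have [->|_] := eqVneq v (last y p); rewrite ?addn0 ?addn1 => -> //.
by case: (degree f _) dz => [|[]].
Qed.

Lemma unbalanced_compl f : half f -> unbalanced (compl f) = unbalanced f.
Proof.
case=> _ fe _; apply/setP => v; rewrite !inE.
case: (boolP (v \in Y)) => //= vY; have := degree_diff_rel v fe.
by rewrite degree_Y //; clear; lia.
Qed.

Lemma balanced_exists : exists f, balanced f.
Proof.
have [f0 hf0] := half_exists.
have [n] := ubnP #|unbalanced f0|; elim: n f0 hf0 => // n IH f hf /ltnSE lefn.
have [b0|[y]] := set_0Vmem (unbalanced f).
  exists f; split=> // y yY; have := in_set0 y; rewrite -b0 inE yY /=.
  have [_ fe _] := hf; have := degree_diff_rel y fe.
  by rewrite degree_Y //; clear; lia.
rewrite inE => /andP[yY /orP[]/eqP fy]; last first.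
  have [f' hf' lt] := overfull_fix hf yY fy.
  exact: IH hf' (leq_trans lt lefn).
(* An empty vertex of [f] is overfull in the complement. The induction continues from the repaired
   complement, since complementing exchanges degrees 0 and 3 on [Y]. *)
have hg := half_compl hf; have [||f' hf' lt] := overfull_fix hg (y := y) => //.
  have [_ fe _] := hf; have := degree_diff_rel y fe.
  by rewrite degree_Y // fy add0n => <-.
by apply: IH hf' (leq_trans _ lefn); rewrite -(unbalanced_compl hf).
Qed.

(** * The exchange process *)

Section Augment.
Variable F : rel T.
Hypothesis Fbal : balanced F.

Let FE : subrel F e. Proof. by case: Fbal => -[]. Qed.
Let Fsym : symmetric F. Proof. by case: Fbal => -[]. Qed.

Lemma degree_balanced_Y y : y \in Y -> degree F y = 1 \/ degree F y = 2.
Proof.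
move=> yY; case: Fbal => _ /(_ y yY).
by case: (degree F y) => [|[|[|]]] //; [left | right].
Qed.

(* A state of the exchange process started from F.  By [dfc_kept], a vertex of
   degree 1 in F keeps degree 1 until its edge of F is gone, so it is a
   leaf as long as it has an unused edge outside F.  By [dfc_new], a vertex
   of X that received an edge outside F has an edge outside F to a vertex of
   degree 2 in F; this guarantees that a component closed up into a cycle still
   has an edge of F that can be deleted. *)
Record deficient f s : Prop := Deficient {
  dfc_sym : symmetric f;
  dfc_sub : subrel f e;
  dfc_X : s \in X;
  dfc_degX : {in X, forall x, degree f x + (x == s) = 2};
  dfc_degY : {in Y, forall y, 0 < degree f y <= 2};
  dfc_kept : forall y w, y \in Y -> degree F y = 1 -> f y w -> F y w ->
    degree f y = 1;
  dfc_new : forall x y, x \in X -> f x y -> ~~ F x y ->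
    exists2 y', compl F x y' & degree F y' = 2 }.

Lemma deficient_deg2 f s v : deficient f s -> degree f v <= 2.
Proof.
move=> df; have /orP[/(dfc_degY df)/andP[] //|/(dfc_degX df) <-] := bipart_cover v.
exact: leq_addr.
Qed.

Lemma deficient_deg1 f s : deficient f s -> degree f s = 1.
Proof. by move=> df; have := dfc_degX df (dfc_X df); rewrite eqxx addn1 => -[]. Qed.

Lemma deficient_Y f s y :
  deficient f s -> y \in Y -> degree f y = 1 \/ degree f y = 2.
Proof.
move=> df /(dfc_degY df); case: (degree f y) => [|[|[|]]] // _; [by left|by right].
Qed.

Lemma degree_compl_X x : x \in X -> degree (compl F) x = 2.
Proof. by case: (half_compl Fbal.1) => _ _; apply. Qed.

Lemma degree_compl_Y y : y \in Y -> degree F y + degree (compl F) y = 3.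
Proof. by move=> yY; rewrite -degree_diff_rel // degree_Y. Qed.

Lemma compl_sym : symmetric (compl F).
Proof. by case: (half_compl Fbal.1). Qed.

Lemma unused_edge f s : deficient f s -> exists2 y, compl F s y & ~~ f s y.
Proof.
move=> df; have := degree_compl_X (dfc_X df) => dc.
have /degree_gt1P[y1 [y2 [h1 h2 y12]]] : 1 < degree (compl F) s by rewrite dc.
have [f1|] := boolP (f s y1); last by exists y1.
have [f2|] := boolP (f s y2); last by exists y2.
by move: y12; rewrite (degree1_eq _ f1 f2) ?eqxx // (deficient_deg1 df).
Qed.

(* If [y] has degree 2 in F, [s y] is its only edge outside F.  If it has degree
   1 in F, it has only two edges outside F, too few for [s y] and those of [f]. *)
Lemma entered_full f s y w :
    deficient f s -> compl F s y -> ~~ f s y -> degree f y = 2 -> f y w -> F y w.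
Proof.
move=> df hsy nfsy fy fyw; have [exy _] := andP hsy.
have yY := bipart_XY (dfc_X df) exy; have DY := degree_compl_Y yY.
have hys : compl F y s by rewrite compl_sym.
have fe := dfc_sub df.
have neq u : f y u -> u != s.
  by apply: contraTneq => ->; rewrite (dfc_sym df).
have big u : f y u -> F y u -> degree F y = 2.
  move=> fyu Fyu; case: (degree_balanced_Y yY) => // F1.
  by have := dfc_kept df yY F1 fyu Fyu; rewrite fy.
have /degree_gt1P[x1 [x2 [f1 f2 x12]]] : 1 < degree f y by rewrite fy.
apply/idPn => nF; have hyw : compl F y w by rewrite /diff_rel /= fe.
have F1 : degree F y = 1.
  case: (degree_balanced_Y yY) => // F2.
  have c1 : degree (compl F) y <= 1 by move: DY; rewrite F2 => /(@addnI 2 _ 1) ->.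
  by have := neq _ fyw; rewrite (degree1_eq c1 hyw hys) eqxx.
have nF' u : f y u -> compl F y u.
  move=> fyu; rewrite /diff_rel /= fe //=; apply/negP => /(big _ fyu).
  by rewrite F1.
have := degree_gt2 (nF' _ f1) (nF' _ f2) hys.
rewrite /= !inE negb_or x12 !neq // => /(_ isT).
by move: DY; rewrite F1 => /(@addnI 1 _ 2) ->.
Qed.

(* Otherwise both edges outside F at [s] lead to leaves of [f]; the component of
   [s] is a path with only one other end, so one leaf is in another component. *)
Lemma deficient_anchor f s :
    deficient f s ->
    (forall y, e s y -> ~~ f s y -> degree f y = 1 -> connect f s y) ->
  exists2 y, compl F s y & degree F y = 2.
Proof.
move=> df stuck; have sX := dfc_X df; have ds := deficient_deg1 df.
have [|w fsw] := degree_gt0P f s _; first by rewrite ds.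
have [Fsw|] := boolP (F s w); last exact: (dfc_new df sX).
have /degree_gt1P[y1 [y2 [h1 h2 y12]]] : 1 < degree (compl F) s.
  by rewrite degree_compl_X.
have leaf y : compl F s y -> degree F y = 1 ->
    [/\ degree f y = 1, connect f s y & s != y].
  move=> hsy F1; have [esy nF] := andP hsy; have yY := bipart_XY sX esy.
  have nf : ~~ f s y.
    apply/negP => fsy; move: nF; rewrite -(@degree1_eq _ f s w y) ?ds //.
    by rewrite Fsw.
  (* At degree 2, [entered_full] gives an edge of [F] at [y] still in [f], and then [dfc_kept]
     forces degree 1. *)
  have d1 : degree f y = 1.
    case: (deficient_Y df yY) => // d2.
    have [|u fyu] := degree_gt0P f y _; first by rewrite d2.
    exact: (dfc_kept df yY F1 fyu (entered_full df hsy nf d2 fyu)).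
  split=> //; [exact: stuck | exact: bipart_neq].
have yY y : compl F s y -> y \in Y by case/andP=> /(bipart_XY sX).
case: (degree_balanced_Y (yY _ h1)) => F1; last by exists y1.
case: (degree_balanced_Y (yY _ h2)) => F2; last by exists y2.
have [[d1 c1 n1] [d2 c2 n2]] := (leaf _ h1 F1, leaf _ h2 F2).
case/eqP: y12; apply: (@connect_leaf_unique _ f s); rewrite ?ds ?d1 ?d2 //.
  exact: dfc_sym df.
by move=> v; apply: deficient_deg2 df.
Qed.

(** The termination measure of the exchange process; ordered pairs count each common edge twice. *)
Definition overlap f := #|[set p : T * T | f p.1 p.2 && F p.1 p.2]|.

(** If [a = y], no degree on [Y] changes. Otherwise [y] and [a] trade the degrees 1 and 2, and
    [dfc_kept] survives because [y] has no edge of [F] left in [f]. The anchor supplies [dfc_new] at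
    [s]. *)
Lemma deficient_swap f s y a b :
    deficient f s -> compl F s y -> ~~ f s y ->
    (exists2 y', compl F s y' & degree F y' = 2) ->
    a \in Y -> f a b -> F a b ->
    a = y \/ [/\ degree f y = 1, degree f a = 2 & forall w, f y w -> ~~ F y w] ->
  deficient (swap_edge f s y a b) b /\ overlap (swap_edge f s y a b) < overlap f.
Proof.
move=> df /andP[esy nF] nf anchor aY fab Fab ay.
have sX := dfc_X df; have yY := bipart_XY sX esy.
have fe := dfc_sub df; have sf := dfc_sym df; have bX := bipart_YX aY (fe _ _ fab).
have sy := bipart_neq sX yY; have ab : a != b by rewrite eq_sym (bipart_neq bX).
have D v := degree_swap_edge v sf sy nf ab fab.
set g := swap_edge f s y a b in D *.
have DX x : x \in X -> degree g x + (x == b) = degree f x + (x == s).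
  move=> xX; have := D x.
  by rewrite (negbTE (bipart_neq xX aY)) (negbTE (bipart_neq xX yY)) !addn0.
have DY v : v \in Y -> degree g v + (v == a) = degree f v + (v == y).
  move=> vY; have := D v; rewrite [v == b]eq_sym [v == s]eq_sym.
  by rewrite (negbTE (bipart_neq bX vY)) (negbTE (bipart_neq sX vY)) !addn0.
have gE v w : g v w -> f v w \/ same_edge s y v w by case/andP=> /orP.
have gF v w : g v w -> F v w -> f v w.
  case/gE=> // /orP[]/andP[/eqP-> /eqP->]; first by rewrite (negbTE nF).
  by rewrite Fsym (negbTE nF).
split; first split=> //.
- exact: swap_edge_sym.
- exact: swap_edge_sub.
- by move=> x xX; rewrite DX // dfc_degX.
- move=> v vY; have := DY v vY; have := dfc_degY df vY.
  case: ay => [->|[y1 a2 _]]; first by move=> + /addIn ->.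
  have [->|va] := eqVneq v a; have [vy|vy] := eqVneq _ y; rewrite ?addn0 ?addn1.
  + by move=> + [->].
  + by rewrite a2 => _ [->].
  + by rewrite vy y1 => _ ->.
  + by move=> + ->.
- move=> v w vY Fv gvw Fvw; have fvw := gF v w gvw Fvw.
  have fv := dfc_kept df vY Fv fvw Fvw; have := DY v vY; rewrite fv.
  case: ay => [->|[_ a2 nFy]]; first by move/addIn.
  have -> : (v == a) = false by apply: contra_eqF a2 => /eqP <-; rewrite fv.
  have -> : (v == y) = false by apply: contraTF Fvw => /eqP E; rewrite E nFy // -E.
  by rewrite !addn0.
- move=> x v xX /gE[|]; first exact: (dfc_new df xX).
  case/orP=> /andP[/eqP xE /eqP vE]; first by rewrite xE.
  by case: (bipart_disj xX); rewrite xE.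
apply/proper_card/properP; split.
  apply/subsetP => -[v w]; rewrite !inE /= => /andP[gvw Fvw].
  by rewrite (gF v w).
exists (a, b); first by rewrite inE /= fab.
by rewrite inE /= /g /swap_edge /del_edge /same_edge /= !eqxx andbF.
Qed.

Lemma deficient_add_edge f s y :
    deficient f s -> e s y -> ~~ f s y -> degree f y = 1 ->
  balanced (add_edge f s y).
Proof.
move=> df esy nf y1; have sX := dfc_X df; have yY := bipart_XY sX esy.
have sy := bipart_neq sX yY.
have D v := degree_add_edge v (dfc_sym df) sy nf.
split; first split.
- exact/add_edge_sym/dfc_sym/df.
- move=> u v /orP[/(dfc_sub df) //|/orP[]/andP[/eqP-> /eqP->] //].
  by rewrite se.
- by move=> x xX; rewrite D (dfc_degX df xX) (negbTE (bipart_neq xX yY)).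
- move=> v vY; rewrite D [v == s]eq_sym (negbTE (bipart_neq sX vY)) addn0.
  have [->|_] := eqVneq v y; first by rewrite y1.
  by rewrite addn0 (dfc_degY df).
Qed.

(** The deletion takes place at [y] when [y] has degree 2 in [f], by [entered_full], or when its
    only edge in [f] belongs to [F]. Otherwise [stuck] puts [y] in the component of [s], and the
    deletion moves to the neighbour [y'] of [s] on the path to [y]. *)
Lemma exchange_edge f s y :
    deficient f s ->
    (forall y, e s y -> ~~ f s y -> degree f y = 1 -> connect f s y) ->
    compl F s y -> ~~ f s y ->
  exists a b, [/\ a \in Y, f a b, F a b,
    a = y \/ [/\ degree f y = 1, degree f a = 2 & forall w, f y w -> ~~ F y w]
    & ~~ connect f s y \/ connect (swap_edge f s y a b) a b].
Proof.
move=> df stuck hsy nf; have [esy nF] := andP hsy.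
have sX := dfc_X df; have yY := bipart_XY sX esy; have sf := dfc_sym df.
have fe := dfc_sub df; have ds := deficient_deg1 df.
have ys : y != s by rewrite eq_sym bipart_neq.
have csf : connect_sym f by apply: sym_connect_sym.
have csw a b : connect_sym (swap_edge f s y a b).
  exact/sym_connect_sym/swap_edge_sym.
have del_sub a b : subrel (connect (del_edge f a b)) (connect (swap_edge f s y a b)).
  apply: sub_connect => u v /andP[fuv n].
  by rewrite /swap_edge /del_edge /= n add_edge_sub.
have swap_new a b : f a b -> connect (swap_edge f s y a b) s y.
  move=> fab; apply: connect1; rewrite /swap_edge /del_edge /=.
  rewrite -/(add_edge f s y s y) add_edge_new /=.
  apply: contra nf => /orP[]/andP[/eqP-> /eqP->] //.
  by rewrite sf.
(* The edge by which [y] starts towards [s] lies on the cycle closed by [s y]. *)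
have own : connect f s y -> exists2 w, f y w & connect (swap_edge f s y y w) y w.
  rewrite csf => /connect_first_edge/(_ ys)[w fyw c]; exists w => //.
  by rewrite csw (connect_trans (del_sub _ _ _ _ c)) ?swap_new.
case: (deficient_Y df yY) => dy; last first.
  have full w := entered_full (w := w) df hsy nf dy.
  have [/own[w fyw c]|nc] := boolP (connect f s y).
    by exists y, w; split=> //; [exact: full|left|right].
  have [|w fyw] := degree_gt0P f y _; first by rewrite dy.
  by exists y, w; split=> //; [exact: full|left|left].
have csy := stuck y esy nf dy; have [w fyw c] := own csy.
have [Fyw|nFyw] := boolP (F y w).
  by exists y, w; split=> //; [left|right].
have nFy w' : f y w' -> ~~ F y w'.
  by move=> fyw'; rewrite (degree1_eq _ fyw' fyw) // dy.
have [|y' fsy' c1] := connect_first_edge csy; first by rewrite eq_sym.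
have y'Y := bipart_XY sX (fe _ _ fsy').
have yy' : y' != y by apply: contraNneq nf => <-.
have [x /andP[fy'x nx] c2] := connect_first_edge c1 yy'.
have xs : x != s.
  by apply: contraNneq nx => ->; rewrite /same_edge /= !eqxx orbT.
have fy's : f y' s by rewrite sf.
have dy' : degree f y' = 2.
  case: (deficient_Y df y'Y) => // d1.
  by move: xs; rewrite (degree1_eq _ fy'x fy's) ?eqxx ?d1.
have del_flip a b : subrel (del_edge f a b) (del_edge f b a).
  by move=> u v; rewrite /del_edge /same_edge /= orbC.
(* The leaf [y] has lost its edge of F and is the far end of the path leaving
   [s] through [y'], [x]; the cycle closed by [s y] is reopened at [y']. *)
have [Fsy'|nFsy'] := boolP (F s y').
  exists y', s; split=> //; [by rewrite Fsym|by right|right].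
  have := del_sub _ _ _ _ (sub_connect (@del_flip _ _) c1).
  by move/connect_trans; apply; rewrite csw swap_new.
have hsy' : compl F s y' by rewrite /diff_rel /= fe.
(* The anchor is one of the two ends [y], [y'] of the edges outside [F] at [s]. It is not [y], whose
   edges [y s] and [y w] both lie outside [F]. *)
have Fy' : degree F y' = 2.
  have [y2 hsy2 F2] := deficient_anchor df stuck.
  suff -> : y' = y2 by [].
  have yy2 : y2 != y.
    apply/eqP => E; move: F2; rewrite E; have := degree_compl_Y yY.
    suff : 1 < degree (compl F) y.
      by case: (degree_balanced_Y yY) => -> //; case: degree => [|[|]].
    apply/degree_gt1P; exists s, w; rewrite [compl _ _ _]compl_sym hsy.
    split=> //; first by rewrite /diff_rel /= fe.
    by apply: contraNneq nf => ->; rewrite sf.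
  apply/eqP/idPn => y'2; have := degree_gt2 hsy hsy' hsy2.
  rewrite degree_compl_X //= !inE negb_or [y == _]eq_sym yy' [y == _]eq_sym yy2.
  by rewrite y'2 => /(_ isT).
(* Degree 2 in [F] leaves [y'] a single edge outside [F], namely [y' s]. *)
have Fy'x : F y' x.
  apply/idPn => nFy'x; have h1 : compl F y' x by rewrite /diff_rel /= fe.
  have h2 : compl F y' s by rewrite compl_sym.
  have d1 : degree (compl F) y' <= 1.
    by have := degree_compl_Y y'Y; rewrite Fy' => /(@addnI 2 _ 1) ->.
  by move: xs; rewrite (degree1_eq d1 h1 h2) eqxx.
exists y', x; split=> //; [by right|right].
have c3 : connect (del_edge f y' x) x y.
  apply: sub_connect c2 => u v /andP[/andP[fuv _] n].
  by rewrite /del_edge /= fuv.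
rewrite csw; apply: connect_trans (del_sub _ _ _ _ c3) _.
rewrite csw; apply: connect_trans (_ : connect _ y' s) (swap_new _ _ fy'x).
apply/del_sub/connect1; rewrite /del_edge /same_edge /= fy's /=.
by rewrite [s == x]eq_sym (negbTE xs) (negbTE (bipart_neq sX y'Y)) !andbF.
Qed.

(** Induction on [overlap]: exchanges never raise the number of components, so the strict drop of
    the final attachment is kept. *)
Lemma deficient_augment f s :
  deficient f s -> exists2 f', balanced f' & n_comp f' predT < n_comp f predT.
Proof.
have [n] := ubnP (overlap f); elim: n f s => // n IH f s /ltnSE le df.
have [/existsP[y /and4P[esy nf /eqP dy nc]]|] :=
    boolP [exists y, [&& e s y, ~~ f s y, degree f y == 1 & ~~ connect f s y]].
  exists (add_edge f s y); first exact: deficient_add_edge df esy nf dy.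
  exact: n_comp_add_edge_lt (dfc_sym df) nc.
rewrite negb_exists => /forallP stuck0.
have stuck y : e s y -> ~~ f s y -> degree f y = 1 -> connect f s y.
  by move=> esy nf dy; have := stuck0 y; rewrite esy nf dy eqxx negbK.
have [y hsy nf] := unused_edge df.
have [a [b [aY fab Fab ay c]]] := exchange_edge df stuck hsy nf.
have [dg lt] := deficient_swap df hsy nf (deficient_anchor df stuck) aY fab Fab ay.
have [f' bf' ltf'] := IH _ _ (leq_trans lt le) dg; exists f' => //.
exact: leq_trans ltf' (n_comp_swap_edge_le (dfc_sym df) fab c).
Qed.

End Augment.

(** The process starts with [F] equal to [f] and one edge of a cycle deleted. Its end in [Y] keeps
    another edge of the cycle, and [dfc_new] holds vacuously. *)
Lemma balanced_cycle_augment f u v :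
    balanced f -> f u v -> connect (del_edge f u v) u v ->
  exists2 f', balanced f' & n_comp f' predT < n_comp f predT.
Proof.
move=> bf; have [[sf fe fX] fY] := bf.
wlog uY : u v / u \in Y.
  move=> W fuv c; have /orP[uY|uX] := bipart_cover u; first exact: W c.
  have vY := bipart_XY uX (fe _ _ fuv); apply: (W v u) => //; first by rewrite sf.
  rewrite sym_connect_sym; last exact: del_edge_sym.
  by apply: sub_connect c => x y; rewrite /del_edge /same_edge /= orbC.
move=> fuv c; have vX := bipart_YX uY (fe _ _ fuv).
have uv : u != v by rewrite eq_sym bipart_neq.
have D x := degree_del_edge x sf uv fuv.
set g := del_edge f u v in c D *.
have gu : 0 < degree g u.
  by have [w guw _] := connect_first_edge c uv; apply/degree_gt0P; exists w.
rewrite -(n_comp_del_edge sf c); apply: (@deficient_augment f bf g v).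
split=> //.
- exact: del_edge_sym.
- by move=> x y /del_edge_sub /fe.
- by move=> x xX; rewrite -(fX x xX) D (negbTE (bipart_neq xX uY)) addn0.
- move=> y yY; have := D y; have := fY y yY.
  rewrite [y == v]eq_sym (negbTE (bipart_neq vX yY)) addn0.
  have [->|_] := eqVneq y u; last by rewrite addn0 => + E; rewrite E.
  by rewrite gu => /andP[_ +] E; rewrite E addn1 => /ltnW.
- move=> y w yY f1 gyw _; have := D y.
  rewrite f1 [y == v]eq_sym (negbTE (bipart_neq vX yY)) addn0.
  have : 0 < degree g y by apply/degree_gt0P; exists w.
  by case: (degree g y) => [|[|n]] // _; case: (y == u).
- by move=> x y _ /del_edge_sub ->.
Qed.

Lemma balanced_forest_exists :
  exists2 f, balanced f & forall u v, f u v -> ~~ connect (del_edge f u v) u v.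
Proof.
have [f0 bf0] := balanced_exists.
have [n] := ubnP (n_comp f0 predT); elim: n f0 bf0 => // n IH f bf /ltnSE le.
have [/existsP[u /existsP[v /andP[fuv c]]]|acyc] :=
    boolP [exists u, exists v, f u v && connect (del_edge f u v) u v].
  have [f' bf' lt] := balanced_cycle_augment bf fuv c.
  exact: IH bf' (leq_trans lt le).
exists f => // u v fuv; apply: contra acyc => c.
by apply/existsP; exists u; apply/existsP; exists v; rewrite fuv.
Qed.

End Bigraph.

(** * Linear forests *)

Section Forest.
Variables (T : finType) (f : rel T).
Hypotheses (sf : symmetric f) (irr : irreflexive f).
Hypothesis deg12 : forall v, 0 < degree f v <= 2.
Hypothesis bridge : forall u v, f u v -> ~~ connect (del_edge f u v) u v.

(** A neighbour of the last vertex [z] on the path must be the predecessor of [z], since an earlier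
    one would close a cycle against [bridge]. Hence one of two neighbours is off the path. *)
Lemma forest_extend x p :
    path f x p -> uniq (x :: p) -> 1 < degree f (last x p) ->
  exists2 w, w \notin x :: p & f (last x p) w.
Proof.
set z := last x p => fp un /degree_gt1P[w1 [w2 [f1 f2 w12]]].
have [i1|] := boolP (w1 \in x :: p); last by exists w1.
have [i2|] := boolP (w2 \in x :: p); last by exists w2.
suff pred w : w \in x :: p -> f z w -> exists l, x :: p = rcons (rcons l w) z.
  have [[l1 E1] [l2]] := (pred _ i1 f1, pred _ i2 f2).
  by rewrite E1 => /rcons_inj[/rcons_inj[_ E]]; rewrite E eqxx in w12.
move=> wp fzw; have wz : w != z by apply: contraTneq fzw => ->; rewrite irr.
have zE : z = last x (x :: p) by [].
rewrite -[path f x p]/(sorted f (x :: p)) in fp.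
case/splitPr: wp fp un zE => l [|y r]; rewrite last_cat /=.
  by move=> _ _ zw; rewrite zw eqxx in wz.
rewrite sorted_cat_cons cat_uniq.
move=> /andP[_ /=/andP[fwy fr]] /and3P[_ _ /and3P[wr yr _]] zE.
case: r zE fr wr yr => [|y' r] zE fr wr yr.
  by exists l; rewrite zE -!cats1 -catA.
have yz : y != z by apply: contraNneq yr => ->; rewrite zE /= mem_last.
have fwz : f w z by rewrite sf.
case/negP: (bridge fwz); apply: connect_trans (connect1 _) (_ : connect _ y z).
  by rewrite /del_edge /same_edge /= fwy (negbTE yz) (negbTE wz) andbF.
by apply/connectP; exists (y' :: r) => //; apply: path_del_edge.
Qed.

(** A longest path through [v] cannot be extended, so its ends have degree at most 1. By
    [sorted_neighbors] it is then closed under [f] and fills the component. *)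
Lemma forest_component_path v :
  nontrivial_path f [set w | connect f v w].
Proof.
pose P n := [exists t : n.-tuple T, [&& sorted f t, uniq t & v \in tval t]].
have P1 : exists n, P n.
  by exists 1; apply/existsP; exists [tuple v]; rewrite /= inE eqxx.
have Pb n : P n -> n <= #|T|.
  by case/existsP=> t /and3P[_ /card_uniqP c _]; rewrite -(size_tuple t) -c max_card.
have [n /existsP[t /and3P[st ut vt]] nmax] := ex_maxnP P1 Pb.
have smax s : sorted f s -> uniq s -> v \in s -> size s <= n.
  by move=> s1 s2 s3; apply: nmax; apply/existsP; exists (in_tuple s); rewrite s1 s2.
have endpoint s : sorted f s -> uniq s -> v \in s -> size s = n ->
    degree f (last v s) <= 1.
  case: s => // x p fp un vp sz; rewrite leqNgt; apply/negP => d.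
  have [w wn fw] := forest_extend fp un d.
  have sw : sorted f (rcons (x :: p) w) by rewrite /= rcons_path fw andbT.
  have := smax _ sw; rewrite size_rcons sz ltnn rcons_uniq wn un.
  by rewrite mem_rcons in_cons vp orbT => /(_ isT isT).
have fsym : (fun x y => f y x) =2 f by move=> x y; rewrite sf.
have dl : degree f (last v t) <= 1 by apply: endpoint; rewrite ?size_tuple.
have dh : degree f (head v t) <= 1.
  (* Reversal reduces the first end to the last one. *)
  have -> : head v t = last v (rev t).
    by case: (tval t) => //= x s; rewrite rev_cons last_rcons.
  apply: endpoint; rewrite ?rev_uniq ?mem_rev ?size_rev ?size_tuple //.
  by rewrite rev_sorted (eq_sorted fsym).
have d2 x : degree f x <= 2 by case/andP: (deg12 x).
have n2 : 1 < size t.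
  have [/degree_gt0P[w fvw] _] := andP (deg12 v).
  rewrite size_tuple; apply: (smax [:: v; w]); rewrite /= ?fvw ?inE ?eqxx ?andbT //.
  by apply: contraTneq fvw => ->; rewrite irr.
have nbr a b : a \in tval t -> f a b -> infix [:: a; b] t || infix [:: b; a] t.
  exact: sorted_neighbors dh dl.
have tconn a : a \in tval t -> connect f (head v t) a.
  case: (tval t) st => // x p fp; exact: path_connect fp _.
have cf : connect_sym f by apply: sym_connect_sym.
have tcl : closed f [in tval t].
  apply: intro_closed => // x y fxy xt.
  by case/orP: (nbr _ _ xt fxy) => /mem_infix; apply; rewrite !inE eqxx ?orbT.
have tC a : (a \in tval t) = connect f v a.
  apply/idP/idP => [ta|/(closed_connect tcl) /= <- //].
  by rewrite (connect_trans _ (tconn _ ta)) // cf tconn.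
exists t => //; split=> // [a|a b]; first by rewrite inE tC.
rewrite !inE -!tC => ta tb; apply/idP/idP => [|]; first exact: nbr.
by case/orP=> /(sorted_infix2 st) //; rewrite sf.
Qed.

End Forest.

(** * Endpoints of component paths and conclusion *)

Lemma listing_head_degree (T : finType) (f : rel T) (C : {set T}) x s :
    path_listing f C (x :: s) -> (forall a b, a \in C -> f a b -> b \in C) ->
  degree f x <= 1.
Proof.
case=> /andP[xs _] sC fC cl.
rewrite leqNgt; apply/negP => /degree_gt1P[w1 [w2 [f1 f2]]].
have xC : x \in C by rewrite -sC mem_head.
(* A neighbour of [x] is consecutive to it in the listing; as [x] occurs only at the front, it must
   be the second entry. *)
suff hd w : f x w -> exists r, s = w :: r.
  by have [r E] := hd _ f1; case/hd: f2 => r'; rewrite E => -[-> _]; rewrite eqxx.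
move=> fxw; move: (fxw); rewrite (fC x w xC (cl x w xC fxw)).
case/orP=> /infix2P[[|y l] [r]] /(congr1 behead) /= E.
- by exists r.
- by move: xs; rewrite E mem_cat mem_head orbT.
- by move: xs; rewrite E mem_head.
- by move: xs; rewrite E mem_cat !inE eqxx !orbT.
Qed.

Lemma path_listing_rev (T : finType) (f : rel T) (C : {set T}) s :
  path_listing f C s -> path_listing f C (rev s).
Proof.
case=> us sC fC; split=> [|x|x y xC yC]; rewrite ?rev_uniq ?mem_rev //.
by rewrite -!infix_revLR (fC x y xC yC) orbC.
Qed.

Lemma path_endpoint_degree (T : finType) (f : rel T) (C : {set T}) v :
  symmetric f -> component f C -> path_endpoint f C v -> degree f v <= 1.
Proof.
move=> sf [c ->] [x [s [L vE]]].
set D := [set w | _] in L; have cl a b : a \in D -> f a b -> b \in D.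
  by rewrite !inE => ca /connect1; apply: connect_trans.
case: vE => ->; first exact: listing_head_degree L cl.
have := path_listing_rev L; rewrite lastI rev_rcons.
by move/listing_head_degree; apply.
Qed.

Theorem theorem5 (T : finType) (e : rel T) (Y X : {set T})
    (Gsimple : simple_graph e) (Gbireg : biregular 3 4 e Y X) :
  exists f : rel T, path_factor e f /\
    forall (C : {set T}) (v : T),
      component f C -> path_endpoint f C v -> degree e v = 3.
Proof.
have [f [[sf fe fX] fY] bridge] := balanced_forest_exists Gsimple Gbireg.
have irr : irreflexive f.
  by move=> x; apply/negP => /fe; case: Gsimple => _ ->.
have deg12 v : 0 < degree f v <= 2.
  by case/orP: (bipart_cover Gbireg v) => [/fY|/fX ->].
exists f; split; first split=> [//|C [v ->]]; first exact: forest_component_path.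
(* Degree at most 1 in [f] excludes [X], where the degree in [f] is 2. *)
move=> C v fC /(path_endpoint_degree sf fC) dv.
case/orP: (bipart_cover Gbireg v) => [|/fX E]; first exact: (degree_Y Gbireg).
by rewrite E in dv.
Qed.
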